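(* Let $\mathbb{V}$ be a vector space of dimension $n$ over a field $\mathbb{F}$ with $2$ elements, and let $\Gamma(\mathbb{V})$ be its non-zero component graph with respect to a basis $\{b_1,\ldots,b_n\}$. Then $I(\Gamma(\mathbb{V}))=n$.
   Context: Non-zero component graph: given a finite-dimensional vector space $\mathbb{V}$ over $\mathbb{F}$ with basis $\{b_1,\ldots,b_n\}$ ($n\ge 1$), $\Gamma(\mathbb{V})$ is the simple graph whose vertices are the non-zero vectors of $\mathbb{V}$; two distinct vertices are adjacent if and only if there is some $b_i$ that has non-zero coefficient in the unique linear combinations (with respect to the basis) of both. For a graph $\Gamma$ and a vertex $u$, $N(u)$ is the set of vertices adjacent to $u$ and $N[u]=N(u)\cup\{u\}$ is the closed neighborhood. A set $I_D\subseteq V(\Gamma)$ is an identifying code for $\Gamma$ if $N[u]\cap I_D\ne\emptyset$ for every $u\in V(\Gamma)$ and $N[u]\cap I_D\ne N[v]\cap I_D$ for all distinct $u,v\in V(\Gamma)$. The identifying number $I(\Gamma)$ is the cardinality of a smallest identifying code of $\Gamma$. *)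

(* Defs.v *)
From HB Require Import structures.
From mathcomp Require Import all_boot all_order all_algebra.
From mathcomp Require Import boolp classical_sets functions cardinality.

Set Implicit Arguments.
Unset Strict Implicit.
Unset Printing Implicit Defensive.

Import GRing.Theory.
Local Open Scope ring_scope.
Local Open Scope classical_set_scope.
Local Open Scope card_scope.

Record simple_graph := SimpleGraph {
  vertex :> Type;
  adj : vertex -> vertex -> Prop;
  adj_irr : forall u, ~ adj u u;
  adj_sym : forall u v, adj u v -> adj v u }.

Definition neighborhood (G : simple_graph) (u : G) : set G :=
  [set v | adj u v].

Definition closed_neighborhood (G : simple_graph) (u : G) : set G :=
  neighborhood u `|` [set u].

Definition identifying_code (G : simple_graph) (D : set G) : Prop :=
  (forall u : G, closed_neighborhood u `&` D !=set0) /\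
  (forall u v : G, u <> v ->
     closed_neighborhood u `&` D <> closed_neighborhood v `&` D).

(* I(G) = k, as a relation: a graph in which two vertices have the same
   closed neighborhood has no identifying
   code at all, so I(G) is only a partial function of G.  The graph may be
   infinite, hence the comparison of cardinals. *)
Definition identifying_number (G : simple_graph) (k : nat) : Prop :=
  (exists D : set G, identifying_code D /\ D #= `I_k) /\
  (forall D : set G, identifying_code D -> `I_k #<= D).

Section NonzeroComponentGraph.
Variables (F : fieldType) (V : vectType F) (n : nat) (b : n.-tuple V).

Definition nzc_vertex : Type := {v : V | v != 0}.

Definition nzc_adj (u v : nzc_vertex) : Prop :=
  u <> v /\ exists i : 'I_n, coord b i (val u) != 0 /\ coord b i (val v) != 0.

Lemma nzc_adj_irr u : ~ nzc_adj u u.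
Proof. by case. Qed.

Lemma nzc_adj_sym u v : nzc_adj u v -> nzc_adj v u.
Proof.
by case=> neq_uv [i [ui vi]]; split; [move=> /esym | exists i].
Qed.

(* Meaningful when b is a basis of V: coord b i v is then the coefficient of
   b_i in the unique expansion of v. *)
Definition nonzero_component_graph : simple_graph :=
  SimpleGraph nzc_adj_irr nzc_adj_sym.

End NonzeroComponentGraph.

(* Main.v *)
(** In one direction the basis vectors form an identifying code: the ones in
    [N[u]] are those in the support of [u], and over a field with two elements a
    vector is determined by its support.  Conversely, for an identifying code
    [D] the map [u |-> N[u] `&` D] sends the [2 ^ n - 1] vertices injectively to
    nonempty subsets of [D]. *)
Require Import Defs.
From mathcomp Require Import all_boot all_order all_algebra.
From mathcomp Require Import boolp classical_sets functions cardinality.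

Set Implicit Arguments.
Unset Strict Implicit.
Unset Printing Implicit Defensive.

Import GRing.Theory.
Local Open Scope ring_scope.
Local Open Scope classical_set_scope.
Local Open Scope card_scope.

(** Separation makes the traces of closed neighborhoods on [D] distinct, and domination makes them
    nonempty; the missing empty set gives the strict inequality. The finite type [T] allows counting
    even when [G] is only a [Type]. *)
Lemma identifying_code_card_lt (G : simple_graph) (D : set G) (k : nat)
    (T : finType) (f : T -> G) :
  identifying_code D -> D #= `I_k -> injective f -> (#|T| < 2 ^ k)%N.
Proof.
move=> [Dne Dsep] /card_set_bijP[g [gk g_inj _]] f_inj.
(* The trace of [u] on [D], carried to a finite subset of ['I_k] along the bijection [g]. *)
pose trace u := [set j : 'I_k | `[< exists2 x,
  (closed_neighborhood u `&` D) x & g x = j >]]%SET.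
have traceP u x (Dx : D x) :
    (Ordinal (gk x Dx) \in trace u) <-> closed_neighborhood u x.
  rewrite finset.inE; split=> [/asboolP[y [uy Dy] /= gyx]|ux]; last first.
    by apply/asboolP; exists x.
  by rewrite -(g_inj y x) ?inE.
have trace_inj : injective (trace \o f).
  move=> s t /= eq_st; apply: f_inj; apply: contrapT => /Dsep; apply.
  by apply/seteqP; split=> x [Nx Dx]; split=> //; apply/(traceP _ _ Dx);
    [rewrite -eq_st | rewrite eq_st]; apply/(traceP _ _ Dx).
have trace_neq0 t : (trace \o f) t != finset.set0.
  have [x [Nx Dx]] := Dne (f t).
  by apply/set0Pn; exists (Ordinal (gk x Dx)); apply/traceP.
(* The image of [trace \o f] is a proper part of the powerset of ['I_k], as it omits the empty
   set. *)
rewrite -[k in (2 ^ k)%N]card_ord -(cardsT 'I_k) -card_powerset.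
rewrite -(card_codom trace_inj).
apply: proper_card; apply/properP; split.
  by apply/fintype.subsetP => A _; rewrite powersetE finset.subsetT.
exists finset.set0; first by rewrite powersetE finset.sub0set.
by apply/negP => /codomP[t t0]; move: (trace_neq0 t); rewrite -t0 eqxx.
Qed.

(** Otherwise [x], 0 and 1 would be three distinct elements. *)
Lemma neq0_eq1_card2 (F : finFieldType) (x : F) :
  #|F| = 2%N -> x != 0 -> x = 1.
Proof.
move=> F2 x0; apply/eqP/negPn/negP => x1.
have : (#|[set x; 0%R; 1%R]%SET| <= 2)%N by rewrite -F2 max_card.
rewrite -finset.setUA cardsU1 cards2 !finset.inE negb_or x0 x1.
by rewrite eq_sym oner_eq0.
Qed.

Section NonzeroComponentGraph.
Variables (F : fieldType) (V : vectType F) (n : nat) (b : n.-tuple V).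
Hypothesis b_free : free b.

Lemma free_nth_neq0 (i : 'I_n) : b`_i != 0.
Proof. by rewrite (free_not0 b_free) // mem_nth // size_tuple. Qed.

Definition basis_vertex (i : 'I_n) : nonzero_component_graph b :=
  exist _ b`_i (free_nth_neq0 i).

Lemma basis_vertex_inj : injective basis_vertex.
Proof.
move=> i j /(congr1 (fun u => coord b i (val u))) /=.
rewrite !coord_free // eqxx; case: eqP => // _ /eqP.
by rewrite oner_eq0.
Qed.

(** The only nonzero coordinate of [b_i] is the [i]-th, so a common component can only be [i].
    Closing the neighborhood covers the case where [u] is [b_i] itself. *)
Lemma closed_neighborhood_basis_vertex (u : nonzero_component_graph b) i :
  closed_neighborhood u (basis_vertex i) <-> coord b i (val u) != 0.
Proof.
split=> [[[_ [j [uj]]]|/= <-]|ui] /=.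
- by rewrite coord_free //; have [->|] := eqVneq i j; rewrite ?eqxx.
- by rewrite coord_free // eqxx oner_eq0.
have [<-|neq] := pselect (u = basis_vertex i); [by right|left].
by split=> //; exists i; rewrite ui /= coord_free // eqxx oner_eq0.
Qed.

End NonzeroComponentGraph.

Theorem theorem2p9 (F : finFieldType) (hF : #|F| = 2%N) (n : nat)
    (hn : (0 < n)%N) (V : vectType F) (hV : \dim {:V} = n)
    (b : n.-tuple V) (hb : basis_of {:V} b) :
  identifying_number (nonzero_component_graph b) n.
Proof.
have b_free := basis_free hb.
have bE v : v = \sum_i coord b i v *: b`_i by apply: coord_basis (memvf v).
split.
  exists (range (basis_vertex b_free)); split; last first.
    rewrite (card_eqr card_II); apply: inj_card_eq => i j _ _.
    exact: basis_vertex_inj.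
  split=> [u|u v neq_uv eq_uv].
    have [i ui] : exists i, coord b i (val u) != 0.
      apply/existsP; rewrite -negb_forall; apply: contra (valP u) => /forallP u0.
      by rewrite [val u]bE big1 // => i _; rewrite (eqP (u0 i)) scale0r.
    exists (basis_vertex b_free i); split; last by exists i.
    exact/closed_neighborhood_basis_vertex.
  (* Equal traces give one inclusion of supports; symmetry gives the other. *)
  have supp_sub (x y : nonzero_component_graph b) i :
      closed_neighborhood x `&` range (basis_vertex b_free) =
      closed_neighborhood y `&` range (basis_vertex b_free) ->
      coord b i (val x) != 0 -> coord b i (val y) != 0.
    move=> eq_xy /(closed_neighborhood_basis_vertex b_free) xi.
    apply/(closed_neighborhood_basis_vertex b_free).
    suff [] : (closed_neighborhood y `&` range (basis_vertex b_free))
      (basis_vertex b_free i) by [].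
    by rewrite -eq_xy; split=> //; exists i.
  apply: neq_uv; apply: val_inj; rewrite /= [LHS]bE [RHS]bE.
  apply: eq_bigr => i _; congr (_ *: _).
  (* With equal supports, both coefficients are 0 or both are 1. *)
  have [ui|ui] := eqVneq (coord b i (val u)) 0; last first.
    have vi := supp_sub _ _ i eq_uv ui.
    by rewrite (neq0_eq1_card2 hF ui) (neq0_eq1_card2 hF vi).
  have [-> //|vi] := eqVneq (coord b i (val v)) 0.
  by have := supp_sub _ _ i (esym eq_uv) vi; rewrite ui eqxx.
move=> D Dcode; have [[k Dk]|Dinf] := pselect (finite_set D); last first.
  (* An infinite [D] contains a copy of the naturals, hence of [I_n]. *)
  apply: card_le_trans ((infiniteP _).1 Dinf); exact: subset_card_le.
rewrite (card_le_eqr Dk) card_le_II.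
(* Nonzero coordinate rows form a finite type that indexes vertices injectively. *)
have vec_neq0 (r : {r : 'rV[F]_n | r != 0}) : \sum_i val r 0 i *: b`_i != 0.
  apply: contra (valP r) => /eqP r0; apply/eqP/rowP => i.
  by rewrite mxE -(coord_sum_free _ i b_free) r0 linear0.
pose f r : nonzero_component_graph b := exist (fun v => v != 0) _ (vec_neq0 r).
have f_inj : injective f.
  move=> r s [eq_rs]; apply/val_inj/rowP => i.
  by rewrite -!(coord_sum_free _ i b_free) /= eq_rs.
have := identifying_code_card_lt Dcode Dk f_inj.
(* There are [2 ^ n - 1] such rows, so the strict bound becomes [2 ^ n <= 2 ^ k]. *)
rewrite card_sig cardC1 card_mx hF mul1n prednK ?expn_gt0 //.
by rewrite leq_exp2l.
Qed.
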